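(* Let $n\ge 2$ and let $G_1,\dots,G_n$ be finite groups. If $G_i$ is a solvable SST-group for all $1\le i\le n$ and $(|G_i|,|G_j|)=1$ for all $1\le i,j\le n$ with $i\neq j$, then $G_1\times G_2\times\cdots\times G_n$ is a solvable SST-group.
   Context: All groups are finite. Two subgroups $A,B$ of a group permute if $AB=BA$. A supplement of $H$ in $G$ is a subgroup $K\le G$ with $G=HK$. A subgroup $H$ of a group $G$ is SS-permutable in $G$ if $H$ has a supplement $K$ in $G$ such that $H$ permutes with every Sylow subgroup of $K$ (for all primes). $G$ is an SST-group if SS-permutability is transitive: whenever $H\le K\le G$, $H$ is SS-permutable in $K$ and $K$ is SS-permutable in $G$, then $H$ is SS-permutable in $G$. *)

(* Defs.v *)
From HB Require Import structures.
From mathcomp Require Import all_boot all_fingroup all_solvable.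

Set Implicit Arguments.
Unset Strict Implicit.
Unset Printing Implicit Defensive.

Local Open Scope group_scope.

(* The products below are products of subsets, so that A and B are not
   assumed to commute elementwise. *)
Definition permutes (gT : finGroupType) (A B : {group gT}) : Prop :=
  A * B = B * A :> {set gT}.

Definition supplement (gT : finGroupType) (G H K : {group gT}) : Prop :=
  K \subset G /\ H * K = G.

Definition SS_permutable (gT : finGroupType) (G H : {group gT}) : Prop :=
  H \subset G /\
  exists2 K : {group gT}, supplement G H K &
    forall (p : nat) (P : {group gT}),
      prime p -> p.-Sylow(K) P -> permutes H P.

Definition SST_group (gT : finGroupType) (G : {group gT}) : Prop :=
  forall H K : {group gT}, H \subset K -> K \subset G ->
    SS_permutable K H -> SS_permutable G K -> SS_permutable G H.

(* Main.v *)
Require Import Defs.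
From mathcomp Require Import all_boot all_fingroup all_solvable.

(** Let G be the direct product of the G i. Since the orders of the factors are
    pairwise coprime, every subgroup H of G is the product of its projections
    [projXn H i] ([coprime_subgroup_setXn]). Hence H is SS-permutable in G if
    and only if each projection is SS-permutable in the corresponding factor,
    and the transitivity of SS-permutability can be checked in each factor
    separately.

    In one direction, SS-permutability passes to images under any morphism,
    because every Sylow subgroup of the image of a supplement lifts to a Sylow
    subgroup of the supplement ([morphim_SS_permutable]). In the other
    direction, the product of supplements K i of the H i is a supplement of the
    product of the H i, and a Sylow subgroup of it is itself the product of
    Sylow subgroups of the K i, so that the permutability condition holds
    componentwise ([SS_permutable_setXn]). Solvability plays no role in the
    transitivity; that of G is [setXn_sol]. *)

Set Implicit Arguments.
Unset Strict Implicit.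
Unset Printing Implicit Defensive.

Local Open Scope group_scope.

(** The image of any Sylow subgroup of K is a Sylow subgroup of f @* K, hence a
    conjugate of Q, and the conjugating element lifts to K. *)
Lemma morphim_pSylow_lift (aT rT : finGroupType) (D : {group aT})
    (f : {morphism D >-> rT}) (p : nat) (K : {group aT}) (Q : {group rT}) :
    K \subset D -> p.-Sylow(f @* K) Q ->
  exists2 P : {group aT}, p.-Sylow(K) P & Q = (f @* P)%G.
Proof.
move=> sKD sylQ; have [P sylP] := Sylow_exists p K.
have sPD : P \subset D := subset_trans (pHall_sub sylP) sKD.
have [_ /morphimP[x Dx Kx ->] defQ] :=
  Sylow_trans (morphim_pSylow f sPD sylP) sylQ.
exists (P :^ x)%G; first by rewrite pHallJ.
by apply/val_inj; rewrite /= morphimJ.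
Qed.

Lemma morphim_SS_permutable (aT rT : finGroupType) (D : {group aT})
    (f : {morphism D >-> rT}) (G H : {group aT}) :
    G \subset D -> SS_permutable G H ->
  SS_permutable (f @* G)%G (f @* H)%G.
Proof.
move=> sGD [sHG [K [sKG defG] permH]]; split; first exact: morphimS.
have sHD := subset_trans sHG sGD; have sKD := subset_trans sKG sGD.
exists (f @* K)%G => [|p Q p_pr sylQ].
  by split; rewrite ?morphimS //= -morphimMl ?defG.
have [P sylP ->] := morphim_pSylow_lift sKD sylQ.
have sPD := subset_trans (pHall_sub sylP) sKD.
by rewrite /permutes /= -morphimMl // (permH p P) // morphimMl.
Qed.

Section DirectProduct.

Variables (I : finType) (gT : I -> finGroupType).

(** The i-th projection of a subgroup H of the full direct product of the
    groups gT i. *)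
Definition projXn (H : {group {dffun forall i, gT i}}) (i : I)
  : {group gT i} := (dffun_morphism gT i @* H)%G.

Lemma projXnP (H : {group {dffun forall i, gT i}}) i g :
  reflect (exists2 x : {dffun forall i, gT i}, x \in H & g = x i)
          (g \in projXn H i).
Proof.
apply: (iffP idP) => [/morphimP[x _ Hx ->] | [x Hx ->]]; first by exists x.
exact: (mem_morphim (dffun_morphism gT i) (in_setT x)).
Qed.

Lemma projXn_setXn (H : forall i, {group gT i}) i :
  projXn (setXn_group H) i = H i.
Proof. by apply/val_inj; rewrite /= morphim_dffunXn. Qed.

Lemma mulg_setXn (A B : forall i, {group gT i}) :
  setXn A * setXn B = setXn (fun i => (A i * B i)%g).
Proof.
apply/setP=> x; apply/mulsgP/setXnP => [[a b /setXnP Aa /setXnP Bb ->] i | ABx].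
  by rewrite ffunE mem_mulg ?Aa ?Bb.
have /fin_all_exists2[a Aa /fin_all_exists2[b Bb defx]] i :
  exists2 a, a \in A i & exists2 b, b \in B i & x i = a * b.
  by have /mulsgP[a b Aa Bb ->] := ABx i; exists a; last exists b.
exists (finfun a) (finfun b); last by apply/ffunP=> i; rewrite !ffunE.
- by apply/setXnP=> i; rewrite ffunE; apply: Aa.
- by apply/setXnP=> i; rewrite ffunE; apply: Bb.
Qed.

Lemma expg_dffun (x : {dffun forall i, gT i}) m i : (x ^+ m) i = x i ^+ m.
Proof. exact: (morphX (dffun_morphism gT i) m (in_setT x)). Qed.

Variable G : forall i, {group gT i}.
Hypothesis coG : forall i j, i != j -> coprime #|G i| #|G j|.

(** The i-th component of an element x of H also lies in H, viewed in the
    product, since it is a power of x: raising x to the product m of the orders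
    of the other factors kills the other components, and m is invertible modulo
    the order of G i. *)
Lemma coprime_subgroup_setXn (H : {group {dffun forall i, gT i}}) :
  H \subset setXn G -> H = setXn_group (projXn H).
Proof.
move=> sHG; apply/eqP; rewrite eq_sym -val_eqE eqEsubset /=.
apply/andP; split; last first.
  by apply/subsetP=> x Hx; apply/setXnP=> i; apply/projXnP; exists x.
rewrite -setXn_prod prod_subG // => i _.
apply/subsetP=> _ /set1gXnP[_ /projXnP[x Hx ->] ->].
have /setXnP Gx := subsetP sHG x Hx.
set m := (\prod_(j | j != i) #|G j|)%N.
have co_m : coprime #|G i| m.
  rewrite coprime_sym /m.
  apply: (big_ind (fun k => coprime k #|G i|)) => [|a b co_a co_b|j /coG //].
    by rewrite coprime1n.
  by rewrite coprimeMl co_a.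
suff -> : dfung1 (x i) = (x ^+ m) ^+ expg_invn (G i) m by do 2!apply: groupX.
apply/ffunP=> j; rewrite !expg_dffun.
have [<-|ne_ij] := eqVneq i j; first by rewrite dfung1_id expgK ?Gx.
rewrite dfung1_dflt // /m (bigD1 j) 1?eq_sym //=.
by rewrite expgM (expg_cardG (Gx j)) !expg1n.
Qed.

Lemma SS_permutable_setXn (H : forall i, {group gT i}) :
    (forall i, SS_permutable (G i) (H i)) ->
  SS_permutable (setXn_group G) (setXn_group H).
Proof.
move=> ssH; split; first by apply: setXnS => i; case: (ssH i).
have /fin_all_exists2[K supK permK] i := proj2 (ssH i).
have sKG : setXn K \subset setXn G by apply: setXnS => i; case: (supK i).
exists (setXn_group K) => [|p P p_pr sylP].
  split=> //=; rewrite mulg_setXn; apply: eq_setXn => i.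
  by case: (supK i).
(* P is the product of its projections, which are Sylow subgroups of the K i. *)
have sPG := subset_trans (pHall_sub sylP) sKG.
rewrite (coprime_subgroup_setXn sPG) /permutes /= !mulg_setXn.
apply: eq_setXn => i; apply: (permK i p) => //.
by rewrite -(projXn_setXn K i) morphim_pSylow ?subsetT.
Qed.

Lemma coprime_SST_group_setXn :
  (forall i, SST_group (G i)) -> SST_group (setXn_group G).
Proof.
move=> sstG H K sHK sKG ssHK ssKG.
rewrite (coprime_subgroup_setXn (subset_trans sHK sKG)).
apply: SS_permutable_setXn => i.
apply: (sstG i (projXn H i) (projXn K i)); first exact: morphimS.
- by rewrite -(projXn_setXn G i) morphimS.
- exact: morphim_SS_permutable (subsetT K) ssHK.
- by rewrite -[G i]projXn_setXn; apply: morphim_SS_permutable (subsetT _) ssKG.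
Qed.

End DirectProduct.

Theorem theorem1p15 (n : nat) (n_ge2 : 2 <= n)
    (gT : 'I_n -> finGroupType) (G : forall i : 'I_n, {group gT i})
    (solG : forall i : 'I_n, solvable (G i))
    (sstG : forall i : 'I_n, SST_group (G i))
    (coG : forall i j : 'I_n, i != j -> coprime #|G i| #|G j|) :
  solvable (setXn_group G) /\ SST_group (setXn_group G).
Proof.
split; first exact: setXn_sol.
exact: coprime_SST_group_setXn.
Qed.
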